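(* Let $n\ge 2$ be even, let $\Lambda=\mathbb{F}^+_{\mathrm{flip}}$ be the single-vertex rank-2 graph with $n$ edges of each color and the flip commutation relations, and let $\mathcal{N}$ be the abelian normal subgroup of $\Lambda_{\mathrm{ht}}\subseteq\mathcal{O}_\Lambda$ consisting of all elements of $\Lambda_{\mathrm{ht}}$ of the form $\sum_i s_{\mu_i}s_{\nu_i}^*$ with $\mu_i\sim\nu_i$ for all $i$. Then the Thompson group $V_n$ can be faithfully represented in the automorphism group of $\mathcal{N}$, i.e. there is an injective group homomorphism $V_n\to\mathrm{Aut}(\mathcal{N})$.
   Context: **The graph.** $\mathbb{N}$ includes $0$. $\mathbb{F}^+_{\mathrm{flip}}$ is the unital semigroup (category with one object $v$) generated by $e^1_1,\dots,e^1_n,e^2_1,\dots,e^2_n$ subject to $e^1_{\mathbf s}e^2_{\mathbf t}=e^2_{\mathbf s}e^1_{\mathbf t}$ for all $1\le\mathbf s,\mathbf t\le n$. It is a 2-graph with degree functor $d:\Lambda\to\mathbb{N}^2$ given by $d(e^1_{\mathbf s})=(1,0)$, $d(e^2_{\mathbf t})=(0,1)$ (whenever $d(\mu)=p+q$, there are unique $\alpha,\beta$ with $\mu=\alpha\beta$, $d(\alpha)=p$, $d(\beta)=q$). Write $\Lambda^m=d^{-1}(m)$. **Equivalence.** $\Omega_2:=\{(p,q)\in\mathbb{N}^2\times\mathbb{N}^2:p\le q\}$ is a 2-graph with $(p,q)(q,m)=(p,m)$, $d(p,q)=q-p$. $\Lambda^\infty$ is the set of degree-preserving functors $x:\Omega_2\to\Lambda$,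 and $\mu x$ denotes the infinite path obtained by prefixing $\mu\in\Lambda$ to $x\in\Lambda^\infty$. $\mu\sim\nu$ means $\mu x=\nu x$ for all $x\in\Lambda^\infty$. **The C*-algebra and $\Lambda_{\mathrm{ht}}$.** $\mathcal{O}_\Lambda$ is the universal C*-algebra generated by isometries $\{s_\mu\}_{\mu\in\Lambda}$ with $s_v=I$, $s_{\mu\nu}=s_\mu s_\nu$, $s_\mu^*s_\mu=I$, and $\sum_{\mu\in\Lambda^m}s_\mu s_\mu^*=I$ for all $m\in\mathbb{N}^2$. $\Lambda_{\mathrm{ht}}$ is the group (under multiplication) of all unitaries $U\in\mathcal{O}_\Lambda$ which can be written as a finite sum $U=\sum_{i} s_{\alpha_i}s_{\beta_i}^*$ with $\alpha_i,\beta_i\in\Lambda$. **$V_n$.** $V_n$ is the Higman-Thompson group $V_{n,1}$: the group of homeomorphisms $f$ of $\{1,\dots,n\}^{\mathbb{N}}$ for which there are finite words $u_1,\dots,u_m$ and $w_1,\dots,w_m$ such that the cylinder sets of the $u_i$, and likewise those of the $w_i$, partition $\{1,\dots,n\}^{\mathbb{N}}$, and $f(u_iz)=w_iz$ for all $z\in\{1,\dots,n\}^{\mathbb N}$ and all $i$. *)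

(* Defs.v *)
From HB Require Import structures.
From mathcomp Require Import all_boot all_order all_algebra generic_quotient.
From mathcomp Require Import complex.
From mathcomp Require Import all_classical reals topology normedtype.

Set Implicit Arguments.
Unset Strict Implicit.
Unset Printing Implicit Defensive.

Import Order.TTheory GRing.Theory Num.Theory.
Import numFieldNormedType.Exports.
Local Open Scope classical_set_scope.
Local Open Scope quotient_scope.
Local Open Scope ring_scope.

Definition deg2 := (nat * nat)%type.

Definition leD (p q : deg2) : bool := (p.1 <= q.1)%N && (p.2 <= q.2)%N.

Definition subD (q p : deg2) : deg2 := ((q.1 - p.1)%N, (q.2 - p.2)%N).

(* The letter (false, s) stands for e^1_s and (true, s) for e^2_s. *)
Definition flip_word (n : nat) := seq (bool * 'I_n).

(* The congruence of the free monoid generated by e^1_s e^2_t = e^2_s e^1_t. *)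
Inductive flip_cong (n : nat) : flip_word n -> flip_word n -> Prop :=
| flip_cong_comm s t :
    flip_cong [:: (false, s); (true, t)] [:: (true, s); (false, t)]
| flip_cong_refl u : flip_cong u u
| flip_cong_sym u v : flip_cong u v -> flip_cong v u
| flip_cong_trans u v w : flip_cong u v -> flip_cong v w -> flip_cong u w
| flip_cong_cat u u' v v' :
    flip_cong u u' -> flip_cong v v' -> flip_cong (u ++ v) (u' ++ v').

Definition flip_congb (n : nat) : rel (flip_word n) :=
  fun u v => `[< flip_cong u v >].

Lemma flip_congb_refl n : reflexive (@flip_congb n).
Proof. by move=> u; apply/asboolP; exact: flip_cong_refl. Qed.

Lemma flip_congb_sym n : symmetric (@flip_congb n).
Proof. by move=> u v; apply/asboolP/asboolP; exact: flip_cong_sym. Qed.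

Lemma flip_congb_trans n : transitive (@flip_congb n).
Proof.
by move=> v u w /asboolP uv /asboolP vw; apply/asboolP; exact: flip_cong_trans vw.
Qed.

Canonical flip_congb_equiv (n : nat) :=
  EquivRel (@flip_congb n) (@flip_congb_refl n) (@flip_congb_sym n)
    (@flip_congb_trans n).

Definition flip (n : nat) : Type := {eq_quot @flip_congb n}.
HB.instance Definition _ n := Choice.on (flip n).
HB.instance Definition _ n := EqQuotient.on (flip n).

Definition flip_edge (n : nat) (c : bool) (s : 'I_n) : flip n :=
  \pi_(flip n) [:: (c, s)].

Lemma flip_ind n (P : flip n -> Prop) :
  (forall u : flip_word n, P (\pi_(flip n) u)) -> forall x, P x.
Proof. by move=> Pu x; rewrite -[x]reprK. Qed.

Lemma flip_piP n (u v : flip_word n) :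
  \pi_(flip n) u = \pi_(flip n) v <-> flip_cong u v.
Proof. by split=> [/eqmodP/asboolP|uv]; last by apply/eqmodP/asboolP. Qed.

Definition flip_mul (n : nat) (x y : flip n) : flip n :=
  \pi_(flip n) (repr x ++ repr y).

Lemma flip_mul_pi n (u v : flip_word n) :
  flip_mul (\pi_(flip n) u) (\pi_(flip n) v) = \pi_(flip n) (u ++ v).
Proof. by apply/flip_piP/flip_cong_cat; apply/flip_piP; rewrite reprK. Qed.

Fact flip_mulA n : associative (@flip_mul n).
Proof.
move=> x y z; elim/flip_ind: x => u; elim/flip_ind: y => v; elim/flip_ind: z => w.
by rewrite !flip_mul_pi catA.
Qed.

Fact flip_mul1g n : left_id (\pi_(flip n) [::]) (@flip_mul n).
Proof. by move=> x; elim/flip_ind: x => u; rewrite flip_mul_pi. Qed.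

Fact flip_mulg1 n : right_id (\pi_(flip n) [::]) (@flip_mul n).
Proof. by move=> x; elim/flip_ind: x => u; rewrite flip_mul_pi cats0. Qed.

HB.instance Definition _ n :=
  isMonoid.Build (flip n) (@flip_mulA n) (@flip_mul1g n) (@flip_mulg1 n).

Lemma flip_pi_cat n (u v : flip_word n) :
  \pi_(flip n) (u ++ v) = (\pi_(flip n) u * \pi_(flip n) v)%g.
Proof. by rewrite -flip_mul_pi. Qed.

Definition flip_word_deg (n : nat) (u : flip_word n) : deg2 :=
  (count (fun a => ~~ a.1) u, count (fun a => a.1) u).

Definition flip_deg (n : nat) (x : flip n) : deg2 := flip_word_deg (repr x).

(* An element of the flip graph is determined by its degree and by the word
   obtained from it by forgetting colours; this yields unique factorization. *)
Definition flip_letters (n : nat) (x : flip n) : seq 'I_n := map snd (repr x).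

Lemma flip_cong_inv n (u v : flip_word n) : flip_cong u v ->
  flip_word_deg u = flip_word_deg v /\ map snd u = map snd v.
Proof.
elim=> {u v} [||u v _ [-> ->]|u v w _ [-> ->] _ [-> ->]|] //.
by move=> u u' v v' _ [[+ +] +] _ [[+ +] +];
  rewrite /flip_word_deg !map_cat !count_cat => -> -> -> -> -> ->.
Qed.

Lemma flip_deg_pi n (u : flip_word n) :
  flip_deg (\pi_(flip n) u) = flip_word_deg u.
Proof. by have /flip_piP/flip_cong_inv[] := reprK (\pi_(flip n) u). Qed.

Lemma flip_letters_pi n (u : flip_word n) :
  flip_letters (\pi_(flip n) u) = map snd u.
Proof. by have /flip_piP/flip_cong_inv[] := reprK (\pi_(flip n) u). Qed.

Lemma flip_deg1 n : flip_deg (1 : flip n)%g = 0.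
Proof. exact: flip_deg_pi. Qed.

Lemma flip_degM n (x y : flip n) : flip_deg (x * y)%g = flip_deg x + flip_deg y.
Proof.
elim/flip_ind: x => u; elim/flip_ind: y => v.
by rewrite -flip_pi_cat !flip_deg_pi /flip_word_deg !count_cat.
Qed.

Lemma flip_deg_edge n c (s : 'I_n) :
  flip_deg (flip_edge c s) = if c then (0, 1)%N else (1, 0)%N.
Proof. by rewrite flip_deg_pi; case: c. Qed.

Lemma flip_edge_comm n (s t : 'I_n) :
  (flip_edge false s * flip_edge true t = flip_edge true s * flip_edge false t)%g.
Proof. by rewrite -!flip_pi_cat; apply/flip_piP; exact: flip_cong_comm. Qed.

Lemma flip_lettersM n (x y : flip n) :
  flip_letters (x * y)%g = flip_letters x ++ flip_letters y.
Proof.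
elim/flip_ind: x => u; elim/flip_ind: y => v.
by rewrite -flip_pi_cat !flip_letters_pi map_cat.
Qed.

Lemma size_flip_letters n (x : flip n) :
  size (flip_letters x) = ((flip_deg x).1 + (flip_deg x).2)%N.
Proof.
rewrite size_map addnC /flip_deg /flip_word_deg /=.
by rewrite -(count_predC (fun a : bool * 'I_n => a.1) (repr x)).
Qed.

Definition flip_nf (n : nat) (p : nat) (l : seq 'I_n) : flip_word n :=
  map (pair false) (take p l) ++ map (pair true) (drop p l).

Lemma flip_nf_true n p (s : 'I_n) (l : seq 'I_n) : (p <= size l)%N ->
  flip_cong ((true, s) :: flip_nf p l) (flip_nf p (s :: l)).
Proof.
elim: p s l => [|p IH] s [|t l] //= pl; rewrite /flip_nf ?take0 ?drop0 /=;
  try exact: flip_cong_refl.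
apply: (@flip_cong_trans _ _ ((false, s) :: (true, t) :: flip_nf p l)).
  apply/flip_cong_sym/(@flip_cong_cat _ [:: _; _] [:: _; _]).
    exact: flip_cong_comm.
  exact: flip_cong_refl.
exact: (@flip_cong_cat _ [:: _] [:: _] _ _ (flip_cong_refl _) (IH t l pl)).
Qed.

Lemma flip_nfP n (u : flip_word n) :
  flip_cong u (flip_nf (flip_word_deg u).1 (map snd u)).
Proof.
elim: u => [|[c s] u IH]; first exact: flip_cong_refl.
apply: (@flip_cong_trans _ _ ((c, s) :: flip_nf (flip_word_deg u).1 (map snd u))).
  exact: (@flip_cong_cat _ [:: _] [:: _] _ _ (flip_cong_refl _) IH).
case: c => /=; last exact: flip_cong_refl.
by apply: flip_nf_true; rewrite size_map count_size.
Qed.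

Lemma flip_inj n (x y : flip n) :
  flip_deg x = flip_deg y -> flip_letters x = flip_letters y -> x = y.
Proof.
elim/flip_ind: x => u; elim/flip_ind: y => v.
rewrite !flip_deg_pi !flip_letters_pi => duv luv; apply/flip_piP.
apply: flip_cong_trans (flip_nfP u) _.
by rewrite duv luv; exact/flip_cong_sym/flip_nfP.
Qed.

Lemma flip_ex n (p : deg2) (l : seq 'I_n) : size l = (p.1 + p.2)%N ->
  exists x : flip n, flip_deg x = p /\ flip_letters x = l.
Proof.
move=> szl; exists (\pi_(flip n) (flip_nf p.1 l)).
rewrite flip_deg_pi flip_letters_pi; split; last first.
  by rewrite map_cat -!map_comp !map_id cat_take_drop.
rewrite /flip_word_deg !count_cat !count_map /= !count_predT !count_pred0.
by rewrite size_take size_drop szl addn0 add0n addKn; case: p szl => a b /= _;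
  case: ltnP => // ab; congr (_, _); apply/eqP; rewrite eqn_leq ab leq_addr.
Qed.

Lemma flip_factorization n (x : flip n) (p q : deg2) : flip_deg x = p + q ->
  exists! ab : flip n * flip n,
    [/\ x = (ab.1 * ab.2)%g, flip_deg ab.1 = p & flip_deg ab.2 = q].
Proof.
move=> dx; have szx : size (flip_letters x) = ((p.1 + p.2) + (q.1 + q.2))%N.
  by rewrite size_flip_letters dx /= addnACA.
have szp : size (take (p.1 + p.2) (flip_letters x)) = (p.1 + p.2)%N.
  by rewrite size_takel// szx leq_addr.
have szq : size (drop (p.1 + p.2) (flip_letters x)) = (q.1 + q.2)%N.
  by rewrite size_drop szx addKn.
have [a [da la]] := flip_ex szp; have [b [db lb]] := flip_ex szq.
exists (a, b); split=> /= [|[a' b'] /= [xE da' db']].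
  split=> //; apply: flip_inj; first by rewrite flip_degM dx da db.
  by rewrite flip_lettersM la lb cat_take_drop.
have sa' : size (flip_letters a') = (p.1 + p.2)%N by rewrite size_flip_letters da'.
congr (_, _); apply: flip_inj; rewrite ?da ?da' ?db ?db' // ?la ?lb xE.
  by rewrite flip_lettersM take_size_cat.
by rewrite flip_lettersM drop_size_cat.
Qed.

Lemma flip_finite n (m : deg2) : finite_set [set x : flip n | flip_deg x = m].
Proof.
pose F (t : (m.1 + m.2).-tuple 'I_n) : flip n := \pi_(flip n) (flip_nf m.1 t).
apply: (@sub_finite_set _ _ (range F)); last exact/finite_image/finite_finset.
move=> x /= dx; have szx : size (flip_letters x) == (m.1 + m.2)%N.
  by rewrite size_flip_letters dx.
exists (Tuple szx) => //; rewrite /F /=; elim/flip_ind: x dx szx => u.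
rewrite flip_deg_pi flip_letters_pi => <- _; apply/flip_piP.
exact/flip_cong_sym/flip_nfP.
Qed.

Lemma flip_deg0 n (x : flip n) : flip_deg x = 0 -> x = 1%g.
Proof.
have nil (y : flip n) : flip_deg y = 0 -> flip_letters y = [::].
  by move=> dy; apply/nilP; rewrite /nilp size_flip_letters dy.
by move=> dx; apply: flip_inj; rewrite ?(nil x)// ?(nil 1%g)// flip_deg1.
Qed.

Record Omega2 := OmegaMor { src : deg2; tgt : deg2; _ : leD src tgt }.

Record infpath (n : nat) := InfPath {
  path_map :> Omega2 -> flip n;
  path_id : forall a : Omega2, src a = tgt a -> path_map a = 1%g;
  path_comp : forall a b c : Omega2,
    tgt a = src b -> src c = src a -> tgt c = tgt b ->
    (path_map a * path_map b)%g = path_map c;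
  path_deg : forall a : Omega2, flip_deg (path_map a) = subD (tgt a) (src a) }.

Lemma infpath_eq n (x y : infpath n) : x =1 y -> x = y.
Proof.
case: x y => [x x1 x2 x3] [y y1 y2 y3] /= /funext xy.
case: _ / xy y1 y2 y3 => y1 y2 y3.
by congr InfPath; exact: Prop_irrelevance.
Qed.

Lemma leD0 (q : deg2) : leD 0 q.
Proof. by []. Qed.

Definition from0 (q : deg2) : Omega2 := OmegaMor (leD0 q).

(* [segment p q x] is the factor b of the factorization x = a b c in which
   a has degree p and b has degree q - p. *)
Definition segment (n : nat) (p q : deg2) (x : flip n) : flip n :=
  xget 1%g [set b | exists a c, [/\ x = (a * b * c)%g, flip_deg a = p
                                   & flip_deg b = subD q p]].

Lemma leDP (p q : deg2) : leD p q -> q = p + subD q p.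
Proof.
by case: p q => [a b] [c d] /andP[/= ac bd]; apply/esym/pair_equal_spec; split;
  exact: subnKC.
Qed.

Lemma subD_trans (p q r : deg2) : leD p q -> leD q r ->
  subD q p + subD r q = subD r p.
Proof.
case: p q r => [p1 p2] [q1 q2] [r1 r2] /andP[/= pq1 pq2] /andP[/= qr1 qr2].
by apply/pair_equal_spec; split; rewrite /= [LHS]addnC [LHS]addnBA// subnK.
Qed.

Lemma subDDl (p q : deg2) : subD (p + q) p = q.
Proof. by case: p q => [a b] [c d]; rewrite /subD /= !addKn. Qed.

Lemma flip_cancel n (a b a' b' : flip n) : (a * b = a' * b')%g ->
  flip_deg a = flip_deg a' -> a = a' /\ b = b'.
Proof.
move=> ab da; have [[c d] [_ uniq]] := flip_factorization (flip_degM a b).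
have db : flip_deg b = flip_deg b'.
  have := congr1 (@flip_deg n) ab; rewrite !flip_degM da.
  by move=> /(congr1 (subD ^~ (flip_deg a'))); rewrite !subDDl.
have [<- <-] := uniq (a, b) (And3 erefl erefl erefl).
by have [<- <-] := uniq (a', b') (And3 ab (esym da) (esym db)).
Qed.

Lemma segmentE n (p q : deg2) (x a b c : flip n) :
  x = (a * b * c)%g -> flip_deg a = p -> flip_deg b = subD q p ->
  segment p q x = b.
Proof.
move=> xE da db; apply: xget_unique; first by exists a, c.
move=> b' [a' [c' [xE' da' db']]].
have [] := @flip_cancel _ (a' * b')%g c' (a * b)%g c.
- by rewrite -xE' xE.
- by rewrite !flip_degM da da' db db'.
by move=> /flip_cancel[]// ; rewrite da da'.
Qed.

Lemma segment_ex n (p q : deg2) (x : flip n) : leD p q -> leD q (flip_deg x) ->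
  exists a c, [/\ x = (a * segment p q x * c)%g, flip_deg a = p
                & flip_deg (segment p q x) = subD q p].
Proof.
move=> pq /leDP qx.
have [[y c] [/= [xE dy _] _]] := flip_factorization qx.
have [[a b] [/= [yE da db] _]] := flip_factorization (etrans dy (leDP pq)).
by exists a, c; rewrite (@segmentE _ p q x a b c)//; rewrite xE yE.
Qed.

Lemma leDDl (p q : deg2) : leD q (p + q).
Proof. by rewrite /leD /= !leq_addl. Qed.

Lemma path0_deg n (x : infpath n) (q : deg2) : flip_deg (x (from0 q)) = q.
Proof. by rewrite path_deg /subD /= !subn0; case: q. Qed.

Section Prefix.
Context {n : nat} (mu : flip n) (x : infpath n).

(* (mu x)(p, q) is the segment from p to q of the finite path mu x(0, q), whose
   degree dominates q. *)
Let f (a : Omega2) : flip n :=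
  segment (src a) (tgt a) (mu * x (from0 (tgt a)))%g.

Let ex (a : Omega2) : exists b c,
  [/\ (mu * x (from0 (tgt a)) = b * f a * c)%g, flip_deg b = src a
    & flip_deg (f a) = subD (tgt a) (src a)].
Proof.
apply: segment_ex; first by case: a.
by rewrite flip_degM path0_deg leDDl.
Qed.

Fact prefix_deg a : flip_deg (f a) = subD (tgt a) (src a).
Proof. by have [b [c []]] := ex a. Qed.

Fact prefix_id a : src a = tgt a -> f a = 1%g.
Proof.
by move=> aE; apply: flip_deg0; rewrite prefix_deg aE /subD !subnn.
Qed.

Fact prefix_comp a b c : tgt a = src b -> src c = src a -> tgt c = tgt b ->
  (f a * f b)%g = f c.
Proof.
move=> ab ca cb; have [u [v [aE du da]]] := ex a; have [u' [v' [bE du' db]]] := ex b.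
have la : leD (src a) (tgt a) by case: (a).
have lb : leD (src b) (tgt b) by case: (b).
have xE : (x (from0 (tgt b)) = x (from0 (tgt a)) * x b)%g.
  by rewrite (@path_comp _ x (from0 (tgt a)) b (from0 (tgt b))).
have [] := @flip_cancel _ u' (f b * v')%g (u * f a)%g (v * x b)%g.
- by rewrite !mulgA -bE xE !mulgA aE.
- by rewrite flip_degM du du' da -ab -leDP.
move=> u'E _; apply/esym/(@segmentE _ _ _ _ u _ v').
- by rewrite cb bE u'E !mulgA.
- by rewrite ca.
by rewrite flip_degM da db cb ca -ab; rewrite -ab in lb; exact: subD_trans.
Qed.

Definition prefix_path : infpath n := InfPath prefix_id prefix_comp prefix_deg.

End Prefix.

Lemma prefix_path_init n (mu : flip n) (x : infpath n) :
  prefix_path mu x (from0 (flip_deg mu)) = mu.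
Proof.
apply: (@segmentE _ _ _ _ 1%g _ (x (from0 (flip_deg mu)))); rewrite ?mul1g//=.
  exact: flip_deg1.
by rewrite /subD !subn0; case: flip_deg.
Qed.

Lemma prefix_path_shift n (mu : flip n) (x : infpath n) (a b : Omega2) :
  src b = flip_deg mu + src a -> tgt b = flip_deg mu + tgt a ->
  prefix_path mu x b = x a.
Proof.
move=> sE tE; have la : leD (src a) (tgt a) by case: (a).
have xE : x (from0 (tgt a)) = (x (from0 (src a)) * x a)%g.
  by rewrite (@path_comp _ x (from0 (src a)) a (from0 (tgt a))).
have [y yE] : exists y, x (from0 (tgt b)) = (x (from0 (tgt a)) * y)%g.
  have lab : leD (tgt a) (tgt b) by rewrite tE leDDl.
  exists (x (OmegaMor lab)).
  by rewrite (@path_comp _ x (from0 (tgt a)) (OmegaMor lab) (from0 (tgt b))).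
apply: (@segmentE _ _ _ _ (mu * x (from0 (src a)))%g _ y).
- by rewrite yE xE !mulgA.
- by rewrite flip_degM path0_deg.
by rewrite path_deg sE tE /subD /= !subnDl.
Qed.

Definition path_equiv (n : nat) (mu nu : flip n) : Prop :=
  forall x : infpath n, prefix_path mu x = prefix_path nu x.

(* The norm takes its values in R[i]. The algebra structure is introduced through
   [cmul] and [cone], and then declared to be that of an algType R[i], because the
   hierarchy has no common extension of ring and normed module structures. *)
HB.mixin Record isCStarAlgebra (R : realType) A
    of CompleteNormedModule R[i] A := {
  cmul : A -> A -> A;
  cone : A;
  cmulA : associative cmul;
  cmul1x : left_id cone cmul;
  cmulx1 : right_id cone cmul;
  cmulDl : left_distributive cmul +%R;
  cmulDr : right_distributive cmul +%R;
  cone_neq0 : cone != 0;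
  cscaleAl : forall (c : R[i]) (x y : A), c *: cmul x y = cmul (c *: x) y;
  cscaleAr : forall (c : R[i]) (x y : A), c *: cmul x y = cmul x (c *: y);
  star : A -> A;
  starK : involutive star;
  starD : {morph star : x y / x + y};
  starZ : forall (c : R[i]) (x : A), star (c *: x) = c^* *: star x;
  starM : forall x y : A, star (cmul x y) = cmul (star y) (star x);
  norm_submul : forall x y : A, `|cmul x y| <= `|x| * `|y|;
  norm_cstar : forall x : A, `|cmul (star x) x| = `|x| ^+ 2 }.

(* C*-algebras here are unital and nonzero. *)
#[short(type="cstarAlgType")]
HB.structure Definition CStarAlgebra (R : realType) :=
  {A of isCStarAlgebra R A & CompleteNormedModule R[i] A}.

HB.instance Definition _ (R : realType) (A : cstarAlgType R) :=
  GRing.Zmodule_isNzRing.Build (CStarAlgebra.sort A) (@cmulA R A)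
    (@cmul1x R A) (@cmulx1 R A) (@cmulDl R A) (@cmulDr R A) (@cone_neq0 R A).

HB.instance Definition _ (R : realType) (A : cstarAlgType R) :=
  GRing.Lmodule_isLalgebra.Build R[i] (CStarAlgebra.sort A) (@cscaleAl R A).

HB.instance Definition _ (R : realType) (A : cstarAlgType R) :=
  GRing.Lalgebra_isAlgebra.Build R[i] (CStarAlgebra.sort A) (@cscaleAr R A).

Definition unitary (R : realType) (A : cstarAlgType R) (u : A) : Prop :=
  star u * u = 1 /\ u * star u = 1.

Definition cstar_subalgebra (R : realType) (A : cstarAlgType R) (S : set A) :
    Prop :=
  [/\ closed S, S 1,
      forall (c : R[i]) (x y : A), S x -> S y -> S (c *: x + y),
      forall x y : A, S x -> S y -> S (x * y)
    & forall x : A, S x -> S (star x)].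

(* The sum in the last clause is over the finite set Lambda^m, see
   [flip_finite]. *)
Definition is_CK_family (R : realType) (n : nat) (A : cstarAlgType R)
    (s : flip n -> A) : Prop :=
  [/\ s 1%g = 1,
      forall mu nu : flip n, s (mu * nu)%g = s mu * s nu,
      forall mu : flip n, star (s mu) * s mu = 1
    & forall m : deg2,
        \sum_(mu \in [set mu : flip n | flip_deg mu = m]) s mu * star (s mu) = 1].

Definition is_universal_CK (R : realType) (n : nat) (A : cstarAlgType R)
    (s : flip n -> A) : Prop :=
  [/\ is_CK_family s,
      forall S : set A, cstar_subalgebra S -> (forall mu, S (s mu)) -> S = setT
    & forall (B : cstarAlgType R) (t : flip n -> B), is_CK_family t ->
        exists f : {lrmorphism A -> B},
          (forall x, f (star x) = star (f x)) /\ (forall mu, f (s mu) = t mu)].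

Definition CK_sum (R : realType) (n : nat) (A : cstarAlgType R)
    (s : flip n -> A) (r : seq (flip n * flip n)) : A :=
  \sum_(ab <- r) s ab.1 * star (s ab.2).

Definition Lambda_ht (R : realType) (n : nat) (A : cstarAlgType R)
    (s : flip n -> A) : set A :=
  [set U | unitary U /\ exists r, U = CK_sum s r].

Definition calN (R : realType) (n : nat) (A : cstarAlgType R)
    (s : flip n -> A) : set A :=
  [set U | Lambda_ht s U /\ exists r,
    (forall ab, ab \in r -> path_equiv ab.1 ab.2) /\ U = CK_sum s r].

(* Automorphisms of a group [N] sitting in the multiplicative monoid of a ring:
   only the values on [N] matter. *)
Definition Aut_in (A : pzRingType) (N : set A) : set (A -> A) :=
  [set phi | set_bij N N phi /\ {in N &, {morph phi : x y / x * y}}].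

Definition sequences (n : nat) : Type :=
  prod_topology (fun _ : nat => discrete_topology 'I_n).
HB.instance Definition _ n := Topological.on (sequences n).

Definition prepend (n : nat) (u : seq 'I_n) (z : sequences n) : sequences n :=
  fun k => if (k < size u)%N then nth (z 0%N) u k else z (k - size u)%N.

Definition cylinder (n : nat) (u : seq 'I_n) : set (sequences n) :=
  range (prepend u).

Definition homeomorphism (T : topologicalType) (f : T -> T) : Prop :=
  continuous f /\
  exists g : T -> T, [/\ continuous g, cancel f g & cancel g f].

Definition thompson (n : nat) : set (sequences n -> sequences n) :=
  [set f | homeomorphism f /\
    exists (m : nat) (u w : 'I_m -> seq 'I_n),
      [/\ partition setT (fun i => cylinder (u i)) setT,
          partition setT (fun i => cylinder (w i)) setT
        & forall i z, f (prepend (u i) z) = prepend (w i) z]].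
Arguments thompson n : clear implicits.

(* Main.v *)
Require Import Defs.
From mathcomp Require Import all_boot all_order all_algebra.
From mathcomp Require Import complex ring zify.
From mathcomp Require Import all_classical reals topology normedtype.

(** Write [S_w] for the isometry of the path of colour [false] with letters [w].
    A homeomorphism [f] of the Thompson group that replaces the prefixes [u_i]
    by [w_i] is represented by the unitary [U = \sum_i S_(w_i) S_(u_i)^*], the
    usual copy of the group in the Cuntz algebra generated by the [S_w], and
    acts on [calN s] by conjugation with [U].

    Independently of the choice of the words, [U] is characterized by
    [implements]: for all words [v] of some length, [f] sends the cylinder of
    [v] to that of a word [v'] by exchanging prefixes, and [U S_v = S_v'].
    Such an element exists ([implements_sum]), is unique ([implements_uniq]) and
    is multiplicative in [f] ([implements_comp]), which gives a homomorphism.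

    Conjugation preserves [calN s] because two finite paths are equivalent
    exactly when they have the same letters ([path_equivP]): a term
    [s_mu s_nu^*] with [mu] and [nu] having the same letters can be expanded
    until [mu] and [nu] both start with a long word of colour [false],
    necessarily the same one, and then [U] only replaces that word ([calN_conj]).

    For injectivity, let [W] be the unitary sending colour [false] to
    colour [true] ([flip_unitary]). The element of [calN s] equal to [W] on the
    cylinder of [v] and to 1 elsewhere ([twist]) is conjugated to the analogous
    element for the image of that cylinder. If [f] and [g] differ at a point, a
    small enough cylinder around it has disjoint images, and equality of the two
    conjugates would force [W = 1]. This is excluded by the universal
    property: the gauge endomorphism of sign -1 on colour [true] sends [W] to
    [- W] ([flip_unitary_neq1]).

    All of this rests on [S_u^* S_v = 0] for distinct words of the same length,
    that is, projections that sum to 1 are orthogonal ([isometries_orthogonal]).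
    This is a positivity statement in a C*-algebra, obtained here
    from norms alone: if [1 + h] and [1 - h] are contractions, then [h = 0]
    ([norm_pm1_eq0]). *)

Set Implicit Arguments.
Unset Strict Implicit.
Unset Printing Implicit Defensive.

Import Order.TTheory GRing.Theory Num.Theory.
Local Open Scope classical_set_scope.
Local Open Scope ring_scope.

(** * Positivity from the norm, and orthogonality of ranges of isometries *)

Section CStar.
Context {R : realType} {A : cstarAlgType R}.
Implicit Types (x y h p : A).

Lemma star0 : star (0 : A) = 0.
Proof. by apply: (addrI (star 0)); rewrite -starD !addr0. Qed.

Lemma starN x : star (- x) = - star x.
Proof. by apply: (addrI (star x)); rewrite -starD !subrr star0. Qed.

Lemma starMr x y : star (x * y) = star y * star x.
Proof. exact: starM. Qed.

Lemma star1 : star (1 : A) = 1.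
Proof. by rewrite -[LHS]mulr1 -{2}(starK (1 : A)) -starMr mulr1 starK. Qed.

Lemma star_sum (I : Type) (r : seq I) (P : pred I) (F : I -> A) :
  star (\sum_(i <- r | P i) F i) = \sum_(i <- r | P i) star (F i).
Proof. by apply: (big_morph star); [exact: starD | exact: star0]. Qed.

Lemma norm_mul x y : `|x * y| <= `|x| * `|y|.
Proof. exact: norm_submul. Qed.

Lemma norm_starM x : `|star x * x| = `|x| ^+ 2.
Proof. exact: norm_cstar. Qed.

Lemma norm_isometry x : star x * x = 1 -> `|x| = 1.
Proof.
have n1 : `|1 : A| = 1.
  apply: (mulIf (x := `|1 : A|)); first by rewrite normr_eq0 oner_neq0.
  by rewrite mul1r -expr2 -norm_starM star1 mulr1.
move=> xx; apply/eqP; rewrite -(@eqrXn2 _ 2)//.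
by rewrite -norm_starM xx n1 expr1n.
Qed.

Lemma norm_star_isometry x : star x * x = 1 -> `|star x| <= 1.
Proof.
move=> /norm_isometry x1; have [->|sx0] := eqVneq (star x) 0.
  by rewrite normr0.
have sx_gt0 : 0 < `|star x| by rewrite normr_gt0.
rewrite -(ler_pM2l sx_gt0) mulr1 -expr2 -norm_starM starK.
by apply: le_trans (norm_mul _ _) _; rewrite x1 mul1r.
Qed.

(** The unit is an extreme point of the unit ball. Starting from a real number
    [a], follow a symmetric random walk with steps 1 and -1: since [1 + h] and
    [1 - h] are contractions, the norm of [a + m h] is at most the mean of the
    distance to 0 after [m] steps, hence of order the square root of [m], while
    [m h] has norm [m `|h|]. *)
Lemma norm_pm1_eq0 h : `|1 + h| <= 1 -> `|1 - h| <= 1 -> h = 0.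
Proof.
move=> hp hm.
have n1 : `|1 : A| = 1 by apply: norm_isometry; rewrite star1 mulr1.
(* The square root is linearized by [2 k |x| <= k ^ 2 + x ^ 2], which turns the
   estimate into a bound that is preserved by one step of the walk. *)
have walk (k : R[i]) (m : nat) (a : R[i]) : 0 < k -> a \is Num.real ->
    (2 * k) * `|a *: (1 : A) + h *+ m| <= k ^+ 2 + m%:R + a ^+ 2.
  move=> k0; elim: m a => [|m IH] a ar.
    rewrite mulr0n !addr0 normrZ n1 mulr1 -(real_normK ar).
    rewrite -subr_ge0 (_ : _ - _ = (k - `|a|) ^+ 2); last by ring.
    apply: real_exprn_even_ge0 => //.
    by apply: rpredB; [exact: gtr0_real | exact: normr_real].
  set y := a *: (1 : A) + h *+ m.
  have yE : (a *: (1 : A) + h *+ m.+1) *+ 2 =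
      (1 + h) * ((a + 1) *: 1 + h *+ m) + (1 - h) * ((a - 1) *: 1 + h *+ m).
    rewrite [h *+ _]mulrSr addrA -/y scalerDl scalerBl scale1r.
    rewrite !(addrAC _ _ (h *+ m)) -/y mulrDl mulrBl !mul1r mulrDr mulrBr !mulr1.
    rewrite mulr2n; move: (h * y) => z.
    rewrite opprB [RHS]addrACA [y + 1 + _]addrACA subrr addr0.
    rewrite [LHS]addrACA; congr (_ + _).
    by rewrite [z + h]addrC [h - z]addrC addrA addrK.
  have le1 x z : `|x| <= 1 -> `|x * z| <= `|z|.
    move=> x1; apply: le_trans (norm_mul _ _) _.
    by rewrite -[leRHS]mul1r ler_wpM2r.
  have {}yE : `|a *: (1 : A) + h *+ m.+1| *+ 2 <=
      `|(a + 1) *: (1 : A) + h *+ m| + `|(a - 1) *: (1 : A) + h *+ m|.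
    rewrite -normrMn yE.
    by apply: le_trans (ler_normD _ _) (lerD _ _); exact: le1.
  have k2 : 0 < 2 * k by rewrite mulr_gt0.
  rewrite -(ler_pMn2r (isT : (0 < 2)%N)) -mulrnAr.
  apply: (le_trans (y := 2 * k * (`|(a + 1) *: 1 + h *+ m| +
                                 `|(a - 1) *: 1 + h *+ m|))).
    by rewrite ler_pM2l.
  rewrite mulrDr; apply: le_trans (lerD (IH _ _) (IH _ _)) _.
  - exact: rpredD ar (real1 _).
  - exact: rpredB ar (real1 _).
  by rewrite -natr1 le_eqVlt; apply/orP; left; apply/eqP; ring.
have bound (k : nat) : k%:R * `|h| <= 1.
  case: k => [|k]; first by rewrite mul0r.
  set K : R[i] := k.+1%:R; have K0 : 0 < K by rewrite ltr0n.
  (* After [K ^ 2] steps the estimate is [2 K (K ^ 2 `|h|) <= K ^ 2 + K ^ 2]. *)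
  have := walk K (k.+1 ^ 2)%N 0 K0 (rpred0 _).
  rewrite scale0r add0r normrMn -[`|h| *+ _]mulr_natl !natrX -/K expr0n addr0 => H.
  have K2 : 0 < 2 * K ^+ 2 by rewrite mulr_gt0// exprn_gt0.
  rewrite -(ler_pM2l K2); apply: le_trans _ (le_trans H _);
    rewrite le_eqVlt; apply/orP; left; apply/eqP; ring.
apply/eqP; rewrite -normr_eq0; apply/negPn/negP => h0.
have : 0 < `|h| by rewrite lt_def h0 normr_ge0.
have := bound; case: `|h| => r t; rewrite ltcE /= => {}bound /andP[/eqP t0 r0].
have rV0 : 0 < r^-1 by rewrite invr_gt0.
have := archi_boundP (ltW rV0); rewrite -(ltr_pM2r r0) mulVf ?gt_eqF//.
apply/negP; rewrite -leNgt.
have := bound (Num.Def.archi_bound r^-1); rewrite t0.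
rewrite -[Complex r 0]/(real_complex R r) -(rmorph_nat (real_complex R)) -rmorphM.
by rewrite -(rmorph1 (real_complex R)) lecR.
Qed.

(** The condition [`|1 - x *+ 2| <= 1] says, for self-adjoint [x], that
    [0 <= x <= 1], in a form that is stable under sums after rescaling the unit.
    It gives both bounds that [norm_pm1_eq0] asks of a multiple of [h]: one from
    [h], one from the other terms, whose sum is [- h]. *)
Lemma sum_eq0_norm (h : A) (r : seq A) : `|1 - h *+ 2| <= 1 ->
  {in r, forall x, `|1 - x *+ 2| <= 1} -> h + \sum_(x <- r) x = 0 -> h = 0.
Proof.
move=> h1 r1 hr.
have rE : \sum_(x <- r) x = - h by apply/eqP; rewrite -addr_eq0 addrC hr.
have n1 : `|1 : A| = 1 by apply: norm_isometry; rewrite star1 mulr1.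
have {}r1 : `|(size r)%:R + h *+ 2 : A| <= (size r)%:R.
  rewrite -[h *+ 2]opprK -mulNrn -rE {h h1 hr rE}.
  elim: r r1 => [|x r IH] r1; first by rewrite big_nil mul0rn subrr normr0.
  rewrite big_cons [x + _]addrC /= mulrSr mulrnDl opprD addrACA [leRHS]mulrSr.
  apply: le_trans (ler_normD _ _) (lerD (IH _) _).
    by move=> y yr; apply: r1; rewrite inE yr orbT.
  by apply: r1; rewrite inE eqxx.
set k : R[i] := (size r).+1%:R; have k0 : 0 < k by rewrite ltr0n.
have kA : k%:A = 1 + (size r)%:R :> A by rewrite scaler_nat mulrS.
have scale (x : A) : `|k%:A + x| <= k -> `|1 + k^-1 *: x| <= 1.
  move=> xk; rewrite -[X in `|X + _|]scale1r -(mulVf (lt0r_neq0 k0)) -scalerA.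
  by rewrite -scalerDr normrZ gtr0_norm ?ler_pM2l ?invr_gt0.
have : k^-1 *: (h *+ 2) = 0.
  apply: norm_pm1_eq0.
    apply: scale; rewrite kA -addrA; apply: le_trans (ler_normD _ _) _.
    by rewrite n1 /k [leRHS]mulrS lerD2l.
  rewrite -scalerN; apply: scale; rewrite kA addrAC.
  apply: le_trans (ler_normD _ _) _.
  by rewrite /k [leRHS]mulrS lerD// -scaler_nat normrZ n1 mulr1 normr_nat.
move=> /eqP; rewrite scaler_eq0 invr_eq0 gt_eqF//= -[h *+ 2]scaler_nat.
by rewrite scaler_eq0 pnatr_eq0 => /eqP.
Qed.

(** Compressing [\sum_k V k * star (V k) = 1] by the isometry [V j] gives a sum
    of positive contractions equal to 1 whose [j]-th term is already 1, so
    the other terms vanish. *)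
Lemma isometries_orthogonal (I : eqType) (r : seq I) (V : I -> A) (i j : I) :
  (forall k, star (V k) * V k = 1) -> \sum_(k <- r) V k * star (V k) = 1 ->
  i \in r -> j \in r -> i != j -> star (V i) * V j = 0.
Proof.
move=> Viso Vsum ir jr ij.
pose h k := star (V j) * (V k * star (V k)) * V j.
have hn k : `|1 - h k *+ 2| <= 1.
  (* A reflection, hence of norm 1. *)
  set q := 1 - (V k * star (V k)) *+ 2.
  have -> : 1 - h k *+ 2 = star (V j) * (q * V j).
    by rewrite /h /q mulrBl mul1r mulrBr Viso mulrnAl mulrnAr !mulrA.
  have q1 : `|q| = 1.
    apply: norm_isometry; have -> : star q = q.
      by rewrite /q starD star1 starN mulr2n starD starMr starK.
    rewrite /q; set p := V k * star (V k).
    have pp : p * p = p by rewrite /p mulrA -[_ * _ * V k]mulrA Viso mulr1.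
    rewrite mulrBr mulr1 mulrBl mul1r mulrnAl mulrnAr pp.
    by move: (p *+ 2) => t; rewrite mulr2n opprB addrK subrK.
  apply: le_trans (norm_mul _ _) _; apply: mulr_ile1 => //.
    exact: norm_star_isometry.
  by apply: le_trans (norm_mul _ _) _; rewrite q1 norm_isometry// mul1r.
have hj : h j = 1 by rewrite /h mulrA Viso mul1r.
have hsum : \sum_(k <- r) h k = 1.
  by rewrite /h -mulr_suml -mulr_sumr Vsum mulr1.
have irj : i \in rem j r.
  by have := ir; rewrite (perm_mem (perm_to_rem jr)) inE (negPf ij).
have : h i = 0.
  apply: (@sum_eq0_norm _ [seq h k | k <- rem i (rem j r)]) => //.
    by move=> x /mapP[k _ ->].
  apply: (addrI 1); rewrite addr0 -[RHS]hsum big_map -hj.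
  rewrite (perm_big _ (perm_to_rem jr)) big_cons.
  by rewrite (perm_big _ (perm_to_rem irj)) big_cons.
rewrite /h => hi0; apply/eqP; rewrite -normr_eq0 -sqrf_eq0 -norm_starM.
by rewrite starMr starK mulrA -[star (V j) * _ * _]mulrA hi0 normr0.
Qed.

End CStar.

(** * Words and Cuntz-Krieger families of the flip graph *)

Definition word n (u : seq 'I_n) : flip n := \pi_(flip n)%qT (map (pair false) u).

Lemma word_deg n (u : seq 'I_n) : flip_deg (word u) = (size u, 0%N).
Proof.
by rewrite flip_deg_pi /flip_word_deg !count_map /= count_predT count_pred0.
Qed.

Lemma word_letters n (u : seq 'I_n) : flip_letters (word u) = u.
Proof. by rewrite flip_letters_pi -map_comp map_id. Qed.

Lemma word_cat n (u v : seq 'I_n) : word (u ++ v) = (word u * word v)%g.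
Proof. by rewrite /word map_cat flip_pi_cat. Qed.

Lemma word_of_deg n (N : nat) (x : flip n) : flip_deg x = (N, 0%N) ->
  x = word (flip_letters x).
Proof.
move=> dx; apply: flip_inj; last by rewrite word_letters.
by rewrite word_deg size_flip_letters dx /= addn0.
Qed.

Section Family.
Context {R : realType} {n : nat} {A : cstarAlgType R} (s : flip n -> A).
Context (hs : is_CK_family s).

Lemma CK1 : s 1%g = 1. Proof. by case: hs. Qed.
Lemma CKM mu nu : s (mu * nu)%g = s mu * s nu. Proof. by case: hs. Qed.
Lemma CKiso mu : star (s mu) * s mu = 1. Proof. by case: hs. Qed.

(** The Cuntz-Krieger relation in degree [m], summed over any parametrization
    of the paths of degree [m] by a finite type. *)
Lemma CK_sum1 (I : finType) (F : I -> flip n) (m : deg2) : injective F ->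
  (forall i, flip_deg (F i) = m) ->
  (forall mu, flip_deg mu = m -> exists i, mu = F i) ->
  \sum_i s (F i) * star (s (F i)) = 1.
Proof.
move=> Finj Fm mF; have [_ _ _ /(_ m) <-] := hs.
rewrite -big_enum -(big_map F predT (fun mu => s mu * star (s mu))).
rewrite fsbig_seq; last by rewrite map_inj_uniq//; exact: enum_uniq.
apply: eq_fsbigl; apply/seteqP; split=> mu /=.
  by move=> /mapP[i _ ->].
by move=> /mF[i ->]; rewrite map_f// mem_enum.
Qed.

Lemma CK_orth mu nu : flip_deg mu = flip_deg nu -> mu != nu ->
  star (s mu) * s nu = 0.
Proof.
move=> munu; have fin := flip_finite n (flip_deg nu).
have [_ _ _ /(_ (flip_deg nu))] := hs; rewrite fsbig_finite// => sum1.
by apply: (isometries_orthogonal (CKiso) sum1); rewrite in_fset_set// inE.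
Qed.

Lemma word_sum1 (N : nat) :
  \sum_(v : N.-tuple 'I_n) s (word v) * star (s (word v)) = 1.
Proof.
apply: (@CK_sum1 _ (fun v : N.-tuple 'I_n => word v) (N, 0%N)).
- by move=> u v /(congr1 (@flip_letters n)); rewrite !word_letters => /val_inj.
- by move=> v; rewrite word_deg size_tuple.
move=> mu dmu; have sz : size (flip_letters mu) == N.
  by rewrite size_flip_letters dmu addn0.
by exists (Tuple sz); rewrite -(word_of_deg dmu).
Qed.

Lemma edge_sum1 (c : bool) :
  \sum_(t < n) s (flip_edge c t) * star (s (flip_edge c t)) = 1.
Proof.
apply: (@CK_sum1 _ (flip_edge c) (if c then (0, 1)%N else (1, 0)%N)).
- by move=> u v /(congr1 (@flip_letters n)); rewrite !flip_letters_pi => -[].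
- by move=> t; rewrite flip_deg_edge.
move=> mu dmu; have : size (flip_letters mu) = 1%N.
  by rewrite size_flip_letters dmu; case: c dmu.
case l : (flip_letters mu) => [|t [|]]// _; exists t.
by apply: flip_inj; rewrite ?flip_deg_edge// l flip_letters_pi.
Qed.

Lemma edge_orth (c : bool) (t r : 'I_n) :
  star (s (flip_edge c t)) * s (flip_edge c r) = (t == r)%:R.
Proof.
have [->|tr] := eqVneq t r; first exact: CKiso.
apply: CK_orth; first by rewrite !flip_deg_edge.
apply: contra_neq tr => /(congr1 (@flip_letters n)).
by rewrite !flip_letters_pi => -[].
Qed.

Lemma word_orth (u v : seq 'I_n) : size u = size v -> u != v ->
  star (s (word u)) * s (word v) = 0.
Proof.
move=> uv nuv; apply: CK_orth; first by rewrite !word_deg uv.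
by apply: contra_neq nuv => /(congr1 (@flip_letters n)); rewrite !word_letters.
Qed.

Lemma word_orth_prefix (u v : seq 'I_n) : (size u <= size v)%N ->
  ~~ prefix u v -> star (s (word u)) * s (word v) = 0.
Proof.
move=> uv; rewrite prefixE => nuv.
rewrite -(cat_take_drop (size u) v) word_cat CKM mulrA word_orth ?mul0r//.
  by rewrite size_takel.
by rewrite eq_sym.
Qed.

(** The unitary that turns colour [false] into colour [true]: multiplying
    [s (flip_edge false t)] by it on the left gives [s (flip_edge true t)]. *)
Definition flip_unitary : A :=
  \sum_(t < n) s (flip_edge true t) * star (s (flip_edge false t)).

Lemma flip_unitaryP : unitary flip_unitary.
Proof.
have H c c' : \sum_(t < n) s (flip_edge c' t) * star (s (flip_edge c t)) *
   (\sum_(t < n) s (flip_edge c t) * star (s (flip_edge c' t))) = 1.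
  rewrite -(edge_sum1 c'); apply: eq_bigr => t _.
  rewrite mulr_sumr (bigD1 t)//= big1 ?addr0 => [|r rt].
    by rewrite -mulrA [star _ * (_ * _)]mulrA edge_orth eqxx mul1r.
  rewrite -mulrA [star _ * (_ * _)]mulrA edge_orth eq_sym (negPf rt).
  by rewrite mul0r mulr0.
have sE : star flip_unitary =
    \sum_(t < n) s (flip_edge false t) * star (s (flip_edge true t)).
  by rewrite star_sum; apply: eq_bigr => t _; rewrite starMr starK.
by split; rewrite sE /flip_unitary mulr_suml H.
Qed.

End Family.

(** * Sequences and prefixes *)

Section Sequences.
Context {n : nat}.
Implicit Types (u v w : seq 'I_n) (z : sequences n).

Lemma prependE (i : 'I_n) u z k :
  prepend u z k = if (k < size u)%N then nth i u k else z (k - size u)%N.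
Proof.
by rewrite /prepend; case: ifP => // ku; exact: set_nth_default.
Qed.

Lemma prepend_cat u v z : prepend (u ++ v) z = prepend u (prepend v z).
Proof.
apply/funext => k; have i : 'I_n := z 0%N.
rewrite !(prependE i) size_cat nth_cat; case: (ltnP k (size u)) => ku.
  by rewrite ltn_addr.
by rewrite -ltn_subLR// subnDA.
Qed.

Lemma prepend_drop z N :
  z = prepend (mkseq z N) (fun k => z (N + k)%N).
Proof.
apply/funext => k; rewrite (prependE (z 0%N)) size_mkseq.
by case: ltnP => kN; [rewrite nth_mkseq | rewrite subnKC].
Qed.

Lemma prepend_eq_prefix u v z z' : prepend u z = prepend v z' ->
  (size u <= size v)%N -> prefix u v.
Proof.
move=> uv uv_size; have i : 'I_n := z 0%N.
rewrite prefixE; apply/eqP/(@eq_from_nth _ i); first by rewrite size_takel.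
move=> k; rewrite size_takel// => ku; rewrite nth_take//.
have := congr1 (fun x : sequences n => x k) uv; rewrite !(prependE i) ku.
by rewrite (leq_trans ku uv_size).
Qed.

(** If [v] were [u] followed by a nonempty word, a constant sequence whose
    letter differs from the first letter of that word would tell them apart. *)
Lemma prepend_inj u v : (2 <= n)%N ->
  (forall z, prepend u z = prepend v z) -> u = v.
Proof.
move=> hn; wlog uv : u v / (size u <= size v)%N.
  move=> H e; have [uv|/ltnW vu] := leqP (size u) (size v); first exact: H.
  by apply/esym/H => // z; rewrite e.
move=> e; have i : 'I_n := Ordinal (ltnW hn).
have /prefixP[[|a y] vE] := prepend_eq_prefix (e (fun=> i)) uv.
  by rewrite vE cats0.
have [b ab] : exists b : 'I_n, b != a.
  have [a0|a0] := eqVneq (nat_of_ord a) 0%N.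
    by exists (Ordinal hn); apply/eqP => /(congr1 val) /=; rewrite a0.
  by exists (Ordinal (ltnW hn)); rewrite -val_eqE /= eq_sym.
have := congr1 (fun x : sequences n => x (size u)) (e (fun=> b)).
rewrite !(prependE i) ltnn vE size_cat /= addnS ltnS leq_addr nth_cat ltnn subnn /=.
by move=> ba; rewrite ba eqxx in ab.
Qed.

End Sequences.

(** * Elements of the algebra implementing maps of sequences *)

Section Implements.
Context {R : realType} {n : nat} {A : cstarAlgType R} (s : flip n -> A).
Context (hn : (2 <= n)%N).
Context (hs : is_CK_family s).

(** [U] carries the isometry of every word of some fixed length the way [f]
    carries the corresponding cylinder. *)
Definition implements (f : sequences n -> sequences n) (U : A) : Prop :=
  exists N, forall v : seq 'I_n, size v = N -> exists v',
    (forall z, f (prepend v z) = prepend v' z) /\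
    U * s (word v) = s (word v').

(** The same holds of all longer words, and [f] shortens prefixes by at most
    [N]; this makes the relation composable. *)
Lemma implements_long f U : implements f U -> exists N,
  forall v : seq 'I_n, (N <= size v)%N -> exists v',
  [/\ (size v <= N + size v')%N, forall z, f (prepend v z) = prepend v' z
    & U * s (word v) = s (word v')].
Proof.
move=> [N H]; exists N => v Nv; have [v' [fv Uv]] := H _ (size_takel Nv).
exists (v' ++ drop N v); split.
- by rewrite size_cat size_drop addnCA subnKC ?leq_addl.
- by move=> z; rewrite -{1}(cat_take_drop N v) !prepend_cat fv.
by rewrite -{1}(cat_take_drop N v) !word_cat !(CKM hs) mulrA Uv.
Qed.

(** On long words both elements are prescribed by [f], and the range
    projections of the words of a given length sum to 1. *)
Lemma implements_uniq f U V : implements f U -> implements f V -> U = V.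
Proof.
move=> /implements_long[N HU] /implements_long[M HV].
rewrite -[U]mulr1 -[V]mulr1 -(word_sum1 hs (maxn N M)) !mulr_sumr.
apply: eq_bigr => v _; rewrite !mulrA.
have [|v' [_ fv ->]] := HU v; first by rewrite size_tuple leq_maxl.
have [|v'' [_ gv ->]] := HV v; first by rewrite size_tuple leq_maxr.
by rewrite (@prepend_inj _ v' v'' hn)// => z; rewrite -fv -gv.
Qed.

Lemma implements_id : implements id 1.
Proof. by exists 0%N => v _; exists v; rewrite mul1r. Qed.

Lemma implements_comp f g U V :
  implements f U -> implements g V -> implements (f \o g) (U * V).
Proof.
move=> /implements_long[N HU] /implements_long[M HV].
exists (N + M)%N => v sv; have [|v' [v'v gv Vv]] := HV v.
  by rewrite sv leq_addl.
have [|v'' [_ fv Uv]] := HU v'.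
  by move: v'v; rewrite sv addnC leq_add2l.
exists v''; split=> [z|]; first by rewrite /= gv fv.
by rewrite -mulrA Vv Uv.
Qed.

(** Once [v] is at least as long as every [u i], exactly one [u i] is a prefix
    of [v], and by orthogonality it is the only one whose term survives. *)
Lemma implements_sum (m : nat) (u w : 'I_m -> seq 'I_n) f :
  partition setT (fun i => cylinder (u i)) setT ->
  (forall i z, f (prepend (u i) z) = prepend (w i) z) ->
  implements f (\sum_i s (word (w i)) * star (s (word (u i)))).
Proof.
move=> [ucov utriv _] fuw; exists (\max_i size (u i))%N => v sv.
have uv i : (size (u i) <= size v)%N by rewrite sv leq_bigmax.
pose z0 : sequences n := fun=> Ordinal (ltnW hn).
have : cover setT (fun i => cylinder (u i)) (prepend v z0) by rewrite ucov.
move=> [i _ [z _ zE]].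
have /prefixP[y vE] := prepend_eq_prefix zE (uv i).
exists (w i ++ y); split=> [z1|]; first by rewrite vE !prepend_cat fuw.
rewrite mulr_suml (bigD1 i)//= big1 ?addr0 => [|j ji].
  by rewrite vE !word_cat !(CKM hs) -mulrA [star _ * _]mulrA CKiso// mul1r.
rewrite -mulrA (word_orth_prefix hs) ?mulr0//.
apply: contra_neqN ji => /prefixP[y' vE']; apply: utriv => //.
exists (prepend v z0); split.
  by exists (prepend y' z0); rewrite // -prepend_cat -vE'.
by exists (prepend y z0); rewrite // -prepend_cat -vE.
Qed.

(** The adjoint implements the inverse map, so unitarity follows from
    uniqueness of the element implementing the identity. *)
Lemma thompson_implements f : thompson n f -> exists g U,
  [/\ implements f U, implements g (star U) & unitary U].
Proof.
move=> [[_ [g [_ fg gf]]] [m [u [w [pu pw fuw]]]]].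
set U := \sum_i s (word (w i)) * star (s (word (u i))).
have Uf : implements f U by exact: implements_sum.
have Ug : implements g (star U).
  have -> : star U = \sum_i s (word (u i)) * star (s (word (w i))).
    by rewrite star_sum; apply: eq_bigr => i _; rewrite starMr starK.
  by apply: implements_sum => // i z; rewrite -fuw fg.
exists g, U; split=> //; split.
  apply: implements_uniq (implements_comp Ug Uf) _.
  by have -> : g \o f = id by [apply/funext]; exact: implements_id.
apply: implements_uniq (implements_comp Uf Ug) _.
by have -> : f \o g = id by [apply/funext]; exact: implements_id.
Qed.

End Implements.

(** * Equivalence of finite paths *)

Lemma segment_letters n (p q : deg2) (x : flip n) :
  leD p q -> leD q (flip_deg x) ->
  flip_letters (segment p q x) =
  take ((q.1 - p.1) + (q.2 - p.2)) (drop (p.1 + p.2) (flip_letters x)).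
Proof.
move=> pq qx; have [a [c [xE da db]]] := segment_ex pq qx.
rewrite [in RHS]xE -mulgA !flip_lettersM drop_size_cat; last first.
  by rewrite size_flip_letters da.
by rewrite take_size_cat// size_flip_letters db.
Qed.

Lemma prefix_path_letters n (mu : flip n) (x : infpath n) (a : Omega2) :
  flip_letters (Defs.prefix_path mu x a) =
  take (((tgt a).1 - (src a).1) + ((tgt a).2 - (src a).2))
    (drop ((src a).1 + (src a).2)
      (flip_letters mu ++ flip_letters (x (from0 (tgt a))))).
Proof.
rewrite -flip_lettersM; apply: segment_letters; first by case: a.
by rewrite flip_degM path0_deg leDDl.
Qed.

Lemma infpath_of_sequence n (z : sequences n) :
  exists x : infpath n, forall q, flip_letters (x (from0 q)) = mkseq z (q.1 + q.2).
Proof.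
pose l (a : Omega2) : seq 'I_n :=
  mkseq (fun k => z ((src a).1 + (src a).2 + k)%N)
   (((tgt a).1 - (src a).1) + ((tgt a).2 - (src a).2)).
have /choice[F HF] (a : Omega2) : exists y : flip n,
    flip_deg y = subD (tgt a) (src a) /\ flip_letters y = l a.
  by apply: flip_ex; rewrite size_mkseq.
have F1 a : src a = tgt a -> F a = 1%g.
  by move=> aE; apply: flip_deg0; rewrite (HF a).1 aE /subD !subnn.
have F2 a b c : tgt a = src b -> src c = src a -> tgt c = tgt b ->
    (F a * F b)%g = F c.
  move=> ab ca cb; have la : leD (src a) (tgt a) by case: (a).
  have lb : leD (src b) (tgt b) by case: (b).
  apply: flip_inj.
    rewrite flip_degM (HF a).1 (HF b).1 (HF c).1 -ab ca cb subD_trans//.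
    by rewrite ab.
  rewrite flip_lettersM (HF a).2 (HF b).2 (HF c).2 /l ca cb -ab.
  move: la lb; rewrite -ab /leD.
  case: (src a) (tgt a) (tgt b) => [a1 a2] [b1 b2] [c1 c2] /=.
  move=> /andP[a1b1 a2b2] /andP[b1c1 b2c2].
  have -> : (c1 - a1 + (c2 - a2) =
      (b1 - a1 + (b2 - a2)) + (c1 - b1 + (c2 - b2)))%N.
    lia.
  rewrite /mkseq [in RHS]iotaD map_cat add0n; congr (_ ++ _).
  rewrite -[X in _ = map _ (iota X _)]addn0 iotaDl -map_comp.
  apply: eq_map => k /=; congr (z _); lia.
exists (@InfPath n F F1 F2 (fun a => (HF a).1)) => q /=.
by rewrite (HF _).2 /l /= !subn0.
Qed.

(** An infinite path amounts to a sequence of letters, and prefixing a finite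
    path acts on that sequence through its letters, whatever their colours. *)
Lemma path_equivP n (mu nu : flip n) : (2 <= n)%N ->
  path_equiv mu nu <-> flip_letters mu = flip_letters nu.
Proof.
move=> hn; split=> [munu|lmunu x]; last first.
  apply: infpath_eq => a; apply: flip_inj; first by rewrite !path_deg.
  by rewrite !prefix_path_letters lmunu.
apply: (prepend_inj hn) => z; apply/funext => k.
have [x xz] := infpath_of_sequence z.
have := congr1 (fun y : infpath n =>
  nth (z 0%N) (flip_letters (y (from0 (k.+1, 0%N)))) k) (munu x).
rewrite !prefix_path_letters /= xz /= subn0 subnn !addn0 drop0 !nth_take//.
have pE (u : seq 'I_n) : nth (z 0%N) (u ++ mkseq z k.+1) k = prepend u z k.
  rewrite (prependE (z 0%N)) nth_cat; case: ltnP => // uk.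
  by rewrite nth_mkseq// ltnS leq_subr.
by rewrite !drop0 !pE.
Qed.

Lemma word_prefix_factor n (N : nat) (mu : flip n) : (N <= (flip_deg mu).1)%N ->
  exists b, mu = (word (take N (flip_letters mu)) * b)%g.
Proof.
move=> Nmu.
have dmu : flip_deg mu = (N, 0%N) + ((flip_deg mu).1 - N, (flip_deg mu).2)%N.
  by apply/pair_equal_spec; rewrite /= [RHS]subnKC.
have [[a b] [/= [abE da _] _]] := flip_factorization dmu; exists b.
have la : size (flip_letters a) = N by rewrite size_flip_letters da addn0.
by rewrite {1 2}abE flip_lettersM take_size_cat// -(word_of_deg da).
Qed.

(** * The group of path-equivalent sums *)

Section Kernel.
Context {R : realType} {n : nat} {A : cstarAlgType R} (s : flip n -> A).
Context (hn : (2 <= n)%N).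
Context (hs : is_CK_family s).

Lemma calNP X : calN s X <-> unitary X /\ exists r,
  (forall ab, ab \in r -> flip_letters ab.1 = flip_letters ab.2) /\ X = CK_sum s r.
Proof.
split=> [[[uX _] [r [rl rX]]]|[uX [r [rl rX]]]].
  by split=> //; exists r; split=> // ab /rl/(path_equivP _ _ hn).
split; first by split=> //; exists r.
by exists r; split=> // ab /rl/(path_equivP _ _ hn).
Qed.

(** After extending [mu] and [nu] by words of length [N], both begin with the
    same word [u] of length [N] and colour [false], and [U] replaces it by the
    same word [u'] in both. *)
Lemma conj_pair f U mu nu : implements s f U ->
  flip_letters mu = flip_letters nu ->
  exists r, (forall ab, ab \in r -> flip_letters ab.1 = flip_letters ab.2) /\
    U * (s mu * star (s nu)) * star U = CK_sum s r.
Proof.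
move=> [N HU] munu.
have /choice[F HF] (v : N.-tuple 'I_n) : exists ab : flip n * flip n,
    [/\ flip_letters ab.1 = flip_letters ab.2,
        U * s (mu * word v)%g = s ab.1 & U * s (nu * word v)%g = s ab.2].
  have deg (x : flip n) : (N <= (flip_deg (x * word v)%g).1)%N.
    by rewrite flip_degM word_deg size_tuple [leqRHS]/= leq_addl.
  have [b bE] := word_prefix_factor (deg mu).
  have [c cE] := word_prefix_factor (deg nu).
  have lE : flip_letters (mu * word v)%g = flip_letters (nu * word v)%g.
    by rewrite !flip_lettersM munu.
  rewrite -lE in cE; set u := take N _ in bE cE.
  have [|u' [_ Uu]] := HU u.
    by rewrite size_takel// size_flip_letters (leq_trans (deg mu))// leq_addr.
  exists (word u' * b, word u' * c)%g; rewrite /= bE cE !(CKM hs) !mulrA Uu.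
  split=> //; move: lE; rewrite bE cE !flip_lettersM.
  by move=> /eqP; rewrite eqseq_cat// eqxx => /eqP ->.
exists [seq F v | v <- enum {: N.-tuple 'I_n}]; split=> [ab /mapP[v _ ->]|].
  by have [] := HF v.
rewrite /CK_sum big_map big_enum /=.
rewrite -[s mu]mulr1 -(word_sum1 hs N) mulr_sumr mulr_suml mulr_sumr mulr_suml.
apply: eq_bigr => v _; have [_ <- <-] := HF v.
by rewrite !(CKM hs) !starMr !mulrA.
Qed.

Lemma calN_conj f U X : implements s f U -> unitary U -> calN s X ->
  calN s (U * X * star U).
Proof.
move=> Uf [UU' UU] /calNP[[XX' XX] [r [rl rX]]]; apply/calNP; split.
  split; rewrite !starMr starK -!mulrA.
    by rewrite (mulrA (star U) U) UU' mul1r (mulrA (star X)) XX' mul1r.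
  by rewrite (mulrA (star U) U) UU' mul1r (mulrA X) XX mul1r.
rewrite {XX' XX}rX; elim: r rl => [|[mu nu] r IH] rl.
  by exists [::]; rewrite /CK_sum !big_nil mulr0 mul0r.
have [|r1 [r1l r1E]] := IH.
  by move=> ab abr; apply: rl; rewrite inE abr orbT.
have [|r2 [r2l r2E]] := conj_pair (mu := mu) (nu := nu) Uf.
  by apply: (rl (mu, nu)); rewrite inE eqxx.
exists (r2 ++ r1); split=> [ab|].
  by rewrite mem_cat => /orP[/r2l|/r1l].
by rewrite {1}/CK_sum big_cons /= mulrDr mulrDl r2E r1E /CK_sum big_cat.
Qed.

End Kernel.

(** * Elements of the group that detect cylinders *)

Section Corner.
Context {R : realType} {A : cstarAlgType R} (S : A).
Context (SS : star S * S = 1).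

(** The element acting as [a], transported by [S], on the range of [S], and as
    the identity on its complement. *)
Definition corner (a : A) : A := 1 + S * (a - 1) * star S.

Lemma corner1 : corner 1 = 1.
Proof. by rewrite /corner subrr mulr0 mul0r addr0. Qed.

Lemma corner_star a : star (corner a) = corner (star a).
Proof.
by rewrite /corner starD star1 !starMr starK starD starN star1 mulrA.
Qed.

Lemma cornerM a b : corner a * corner b = corner (a * b).
Proof.
have abE : a * b - 1 = (b - 1) + ((a - 1) + (a - 1) * (b - 1)).
  rewrite mulrBr mulr1 mulrBl mul1r [a - 1 + _]addrC subrK.
  by rewrite [RHS]addrC addrA subrK.
rewrite /corner abE; move: (a - 1) (b - 1) => p q.
rewrite mulrDl mul1r mulrDr mulr1 -!addrA; congr (_ + _).
rewrite !mulrDr !mulrDl; congr (_ + (_ + _)).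
by rewrite -!mulrA (mulrA (star S) S) SS mul1r.
Qed.

Lemma corner_unitary a : unitary a -> unitary (corner a).
Proof.
by move=> [aa' aa]; rewrite /unitary corner_star !cornerM aa' aa corner1.
Qed.

End Corner.

Section Twist.
Context {R : realType} {n : nat} {A : cstarAlgType R} (s : flip n -> A).
Context (hn : (2 <= n)%N).
Context (hs : is_CK_family s).

(** The function equal to [flip_unitary] on the cylinder of [v] and to 1 off
    it. *)
Definition twist (v : seq 'I_n) : A := corner (s (word v)) (flip_unitary s).

Lemma twist_calN v : calN s (twist v).
Proof.
apply/(calNP s hn); split.
  exact: (corner_unitary (CKiso hs _) (flip_unitaryP hs)).
exists ([seq (word v * flip_edge true t, word v * flip_edge false t)%g
          | t : 'I_n]
  ++ [seq (word u, word u)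
      | u : (size v).-tuple 'I_n in [pred u | val u != v]]).
split=> [ab|].
  rewrite mem_cat => /orP[] /mapP[t _ ->] //=.
  by rewrite !flip_lettersM !flip_letters_pi.
rewrite /CK_sum big_cat [X in _ = _ X _]big_image [X in _ = _ _ X]big_image /=.
rewrite /twist /corner mulrBr mulr1 mulrBl addrCA; congr (_ + _).
  rewrite /flip_unitary mulr_sumr mulr_suml; apply: eq_bigr => t _.
  by rewrite !(CKM hs) starMr !mulrA.
rewrite -(word_sum1 hs (size v)) [in LHS](bigD1 (in_tuple v))//=.
by rewrite addrC addrA addNr add0r; apply: eq_bigl => u.
Qed.

Lemma conj_twist f U v v' : implements s f U -> unitary U ->
  U * s (word v) = s (word v') ->
  U * twist v * star U = corner (s (word v')) (flip_unitary s).
Proof.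
move=> Uf [_ UU] Uv; rewrite /twist /corner mulrDr mulr1 mulrDl UU; congr (_ + _).
by rewrite -Uv starMr !mulrA.
Qed.

End Twist.

(** The point [(1, -1)] of the gauge action of the torus. *)
Lemma gauge_CK (R : realType) (n : nat) (A : cstarAlgType R) (s : flip n -> A) :
  is_CK_family s ->
  is_CK_family (fun mu => if odd (flip_deg mu).2 then - s mu else s mu).
Proof.
move=> hs; split.
- by rewrite flip_deg1 /= CK1.
- move=> mu nu; rewrite flip_degM /= oddD (CKM hs).
  by case: odd; case: odd; rewrite /= ?mulrNN ?mulrN ?mulNr.
- by move=> mu; case: odd; rewrite ?starN ?mulrNN CKiso.
move=> m; have [_ _ _ /(_ m) sum1] := hs; rewrite -[RHS]sum1.
apply: eq_fsbigr => mu _.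
by case: odd; rewrite // starN mulrNN.
Qed.

(** By universality the gauge action gives an endomorphism of [A], and it sends
    [flip_unitary] to its opposite; it would have to fix the unit. *)
Lemma flip_unitary_neq1 (R : realType) (n : nat) (A : cstarAlgType R)
  (s : flip n -> A) : is_universal_CK s -> flip_unitary s <> 1.
Proof.
move=> [hs _ /(_ A _ (gauge_CK hs))[f [fstar fs]]] W1.
have : f (flip_unitary s) = - flip_unitary s.
  rewrite /flip_unitary rmorph_sum -sumrN; apply: eq_bigr => t _.
  by rewrite rmorphM /= fstar !fs !flip_deg_edge /= mulNr.
rewrite W1 rmorph1 => /eqP; rewrite -addr_eq0 => /eqP h2.
have : (2 : R[i]) *: (1 : A) = 0 by rewrite scaler_nat.
by move=> /eqP; rewrite scaler_eq0 pnatr_eq0 oner_eq0.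
Qed.

(** * The representation of the Thompson group *)

Theorem mainTheorem8 (R : realType) (n : nat) (hn : (2 <= n)%N)
    (heven : ~~ odd n) (A : cstarAlgType R) (s : flip n -> A)
    (hA : is_universal_CK s) :
  exists Phi : (sequences n -> sequences n) -> (A -> A),
    [/\ forall f, f \in thompson n -> Phi f \in Aut_in (calN s),
        {in thompson n &, forall f g,
          {in calN s, Phi (f \o g) =1 Phi f \o Phi g}}
      & {in thompson n &, forall f g,
          {in calN s, Phi f =1 Phi g} -> f = g}].
Proof.
have hs : is_CK_family s by case: hA.
pose U f : A := xget 0 (implements s f).
have UE f V : implements s f V -> U f = V.
  move=> fV; apply: xget_unique => // V' fV'.
  exact: (implements_uniq hn hs fV' fV).
exists (fun f X => U f * X * star (U f)); split.
- move=> f; rewrite !inE => /(thompson_implements hn hs)[g [V [fV gV uV]]].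
  rewrite (UE _ _ fV).
  have uV' : unitary (star V) by case: uV; rewrite /unitary starK.
  have [VV' VV] := uV.
  have VK X : star V * (V * X * star V) * V = X.
    by rewrite !mulrA VV' mul1r -mulrA VV' mulr1.
  split; first split.
  + by move=> X NX; apply: (calN_conj hn hs fV).
  + by move=> X Y _ _ /(congr1 (fun Z => star V * Z * V)); rewrite !VK.
  + move=> Y NY; exists (star V * Y * V).
      by rewrite -{2}(starK V); exact: calN_conj gV uV' NY.
    by rewrite !mulrA VV mul1r -mulrA VV mulr1.
  move=> X Y _ _ /=.
  by rewrite -!mulrA (mulrA (star V) V) VV' mul1r.
- move=> f g; rewrite !inE => /(thompson_implements hn hs)[_ [V [fV _ _]]].
  move=> /(thompson_implements hn hs)[_ [W [gW _ _]]] X _ /=.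
  rewrite (UE _ _ fV) (UE _ _ gW) (UE _ _ (implements_comp hs fV gW)).
  by rewrite starMr !mulrA.
move=> f g; rewrite !inE => /(thompson_implements hn hs)[_ [V [fV _ uV]]].
move=> /(thompson_implements hn hs)[_ [W [gW _ uW]]] fg.
apply: contrapT => nfg.
have [z [k fgz]] : exists z k, f z k <> g z k.
  apply: contrapT => H; apply: nfg; apply/funext => z; apply/funext => k.
  by apply: contrapT => fgz; apply: H; exists z, k.
have [N HV] := implements_long hs fV; have [M HW] := implements_long hs gW.
(* [f] and [g] shorten prefixes by at most [N] and [M], so on the cylinder of
   [v] both images have prefixes reaching beyond the coordinate [k]. *)
set v := mkseq z (maxn N M + k.+1).
have sv : size v = (maxn N M + k.+1)%N by rewrite size_mkseq.
have [|v' [sv' fv Vv]] := HV v.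
  by rewrite sv (leq_trans (leq_maxl N M))// leq_addr.
have [|w' [sw' gv Wv]] := HW v.
  by rewrite sv (leq_trans (leq_maxr N M))// leq_addr.
have kv : (k < size v')%N.
  rewrite -(leq_add2l N); apply: leq_trans sv'.
  by rewrite sv leq_add2r leq_maxl.
have kw : (k < size w')%N.
  rewrite -(leq_add2l M); apply: leq_trans sw'.
  by rewrite sv leq_add2r leq_maxr.
have vw : nth (z 0%N) v' k <> nth (z 0%N) w' k.
  set i := z 0%N; move: fgz; rewrite (prepend_drop z (maxn N M + k.+1)) -/v.
  by rewrite fv gv !(prependE i) kv kw.
have orth : star (s (word v')) * s (word w') = 0.
  have [vw'|/ltnW vw'] := leqP (size v') (size w').
    apply: (word_orth_prefix hs) => //; apply/negP => /prefixP[y w'E].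
    by apply: vw; rewrite w'E nth_cat kv.
  rewrite -[LHS]starK starMr starK (word_orth_prefix hs) ?star0//.
  by apply/negP => /prefixP[y v'E]; apply: vw; rewrite v'E nth_cat kw.
have := fg (twist s v); rewrite inE => /(_ (twist_calN hn hs v)).
rewrite (UE _ _ fV) (UE _ _ gW) (conj_twist fV uV Vv) (conj_twist gW uW Wv).
move=> /addrI /(congr1 (fun X => star (s (word v')) * X * s (word v'))).
rewrite !mulrA orth !mul0r CKiso// mul1r -mulrA CKiso// mulr1 => /eqP.
by rewrite subr_eq0 => /eqP; exact: flip_unitary_neq1.
Qed.
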